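(* Let $p$ be a prime, let $k\geq 1$ and let $\lambda_1\geq\lambda_2\geq\ldots\geq\lambda_t>\lambda_{t+1}=\ldots=\lambda_k=1$ be integers, where $0\leq t\leq k$ is fixed ($t=0$ if each $\lambda_j$ is $1$, and $t=k$ if each $\lambda_j$ is $\geq 2$). Let $G_{\lambda}=\mathbb{Z}_{p^{\lambda_1}}\times\mathbb{Z}_{p^{\lambda_2}}\times\cdots\times\mathbb{Z}_{p^{\lambda_k}}$. Then $$|\mathcal{E}_{p^2}(G_{\lambda})|=\sum_{\substack{1\leq r\leq t\\ 0\leq s\leq k-r}} p^{r(k-r-s)}\binom{k-r}{s}_{p}\binom{t}{r}_{p},$$ which is zero (empty sum) for $t=0$.
   Context: $\mathbb{Z}_n$ denotes the cyclic group of order $n$. For a finite abelian group $G$ and a positive integer $d$, $\mathcal{E}_d(G)=\{H\leq G : \exp(H)=d\}$ is the set of subgroups of $G$ whose exponent is exactly $d$. For integers $0\le k\le n$, the gaussian binomial coefficient is $$\binom{n}{k}_{p}=\frac{\prod_{i=1}^n(p^i-1)}{\prod_{i=1}^k(p^i-1)\prod_{i=1}^{n-k}(p^i-1)},$$ where empty products equal $1$. *)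

(* Defs.v *)
From HB Require Import structures.
From mathcomp Require Import all_boot all_order all_fingroup all_algebra.
From mathcomp Require Import all_solvable.

Set Implicit Arguments.
Unset Strict Implicit.
Unset Printing Implicit Defensive.

Import GroupScope GRing.Theory.

(* 'Z_m carries its additive group structure, and it is cyclic of order m
   only when 1 < m: 'Z_0 and 'Z_1 both denote the group of order 2. *)
Definition cyclic_prod (k : nat) (m : 'I_k -> nat) : finGroupType :=
  {dffun forall i : 'I_k, 'Z_(m i)}.

Definition subgroups_of_exponent (gT : finGroupType) (d : nat) (G : {group gT})
  : {set {group gT}} := [set H : {group gT} | (H \subset G) && (exponent H == d)].

(* The quotient is taken in rat, so that its integrality is not presupposed.
   Only meaningful for m <= n, as n - m is a truncated subtraction. *)
Definition gauss_binom (p n m : nat) : rat :=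
  ((\prod_(1 <= i < n.+1) (p%:R ^+ i - 1)) /
   ((\prod_(1 <= i < m.+1) (p%:R ^+ i - 1)) *
    (\prod_(1 <= i < (n - m).+1) (p%:R ^+ i - 1))))%R.

(* Main.v *)
Require Import Defs.
From mathcomp Require Import all_boot all_order all_fingroup all_algebra.
From mathcomp Require Import all_solvable.
From mathcomp Require Import ring.

(** Write [f x = x ^+ p] for the power endomorphism of the abelian group [G],
[A] for its kernel (order [p ^ k]) and [M] for the image under [f] of the
elements killed by [p ^ 2] (order [p ^ t], contained in [A]). A subgroup [H]
has exponent [p ^ 2] exactly when [1 < f H <= M], and then [f H <= 'ker_H f].
The subgroups of exponent [p ^ 2] are therefore sorted by the pairs
[K = f H], [S = 'ker_H f], where [1 < K <= M] and [K <= S <= A].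

For fixed [K] and [S], the group [f^-1 K / S] is elementary abelian because
[f (f^-1 K) = K <= S], and [H |-> H / S] identifies the subgroups sought with
the complements of [A / S] in it ([card_subgroups_morphim_ker]). If
[|K| = p ^ r] and [|S / K| = p ^ s], there are [p ^ (r * (k - r - s))] of them.
The number of [K] of order [p ^ r] is a gaussian binomial coefficient of [t]
and [r], and the number of [S], viewed as subgroups of order [p ^ s] of the
elementary abelian group [A / K], is one of [k - r] and [s].

Both the gaussian binomials and the number of complements are instances of
one count ([card_subgroups_trivI]): in an elementary abelian group [V] with a
given subgroup [W], the number of subgroups of order [p ^ m] that meet [W]
trivially. It satisfies a first order recursion in [m], obtained by counting
in two ways the pairs of such a subgroup and one of its nontrivial elements,
and passing to the quotient by the subgroup that this element generates. *)

Set Implicit Arguments.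
Unset Strict Implicit.
Unset Printing Implicit Defensive.

Import GroupScope GRing.Theory Num.Theory.

(** * Subgroups of a quotient *)

(** The correspondence theorem as a reindexing rule: this form serves both for
counting and for sums weighted by the order of the subgroup. *)
Lemma big_subgroups_quotient (R : Type) (idx : R) (op : Monoid.com_law idx)
    (gT : finGroupType) (S L : {group gT}) (P : pred {group coset_of S})
    (F : {group coset_of S} -> R) :
    S <| L ->
  \big[op/idx]_(H : {group gT} | [&& S \subset H, H \subset L & P (H / S)%G])
     F (H / S)%G
    = \big[op/idx]_(X : {group coset_of S} | (X \subset L / S) && P X) F X.
Proof.
move=> nSL; have nS (H : {group gT}) : S \subset H -> H \subset L -> S <| H.
  by move=> sSH sHL; apply: normalS nSL.
pose D := [set H : {group gT} | [&& S \subset H, H \subset L & P (H / S)%G]].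
transitivity (\big[op/idx]_(H in D) F (H / S)%G).
  by apply: eq_bigl => H; rewrite inE.
rewrite -(big_imset (h := fun H : {group gT} => (H / S)%G)) /=; last first.
  move=> H1 H2; rewrite !inE => /and3P[S1 L1 _] /and3P[S2 L2 _] /(congr1 val)/= eH.
  by apply: val_inj; rewrite /= -(quotientGK (nS _ S1 L1)) eH quotientGK ?nS.
apply: eq_bigl => X; apply/imsetP/andP.
  by case=> H; rewrite inE => /and3P[SH HL PH] ->; rewrite quotientS.
case=> sXL PX; have [H defX sSH sHL] := inv_quotientS nSL sXL.
have eX : X = (H / S)%G by apply: val_inj.
by exists H; rewrite // inE sSH sHL -eX.
Qed.

Lemma card_subgroups_quotient (gT : finGroupType) (S L : {group gT})
    (P : pred {group coset_of S}) :
    S <| L ->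
  #|[set H : {group gT} | [&& S \subset H, H \subset L & P (H / S)%G]]|
    = #|[set X : {group coset_of S} | (X \subset L / S) && P X]|.
Proof.
move=> nSL; rewrite -!sum1dep_card.
exact: (big_subgroups_quotient addn P (fun=> 1%N) nSL).
Qed.

(** * Elements killed by a power of p in a product of cyclic groups *)

Lemma card_Ldiv_cyclic (gT : finGroupType) (p l e : nat) (G : {group gT}) :
    prime p -> cyclic G -> #|G| = (p ^ l)%N ->
  #|'Ldiv_(p ^ e)(G)| = (p ^ minn e l)%N.
Proof.
move=> p_pr /cyclicP[x ->] ox; have p_gt0 := prime_gt0 p_pr.
have px : p.-elt x by rewrite /p_elt /order ox pnatX pnat_id.
have cOO : abelian 'Ohm_e(<[x]>).
  exact: abelianS (Ohm_sub _ _) (cycle_abelian x).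
rewrite -(OhmEabelian px cOO) (Ohm_p_cycle e px) -orderE.
have lx : logn p #[x] = l by rewrite orderE ox pfactorK.
rewrite lx orderXdiv orderE ox ?dvdn_exp2l ?leq_subr //.
by rewrite -expnB ?leq_subr // -minnE minnC.
Qed.

Lemma card_Ldiv_cyclic_prod (k p e : nat) (lambda : 'I_k -> nat) :
    prime p -> (forall i, 0 < lambda i) ->
  #|'Ldiv_(p ^ e)([set: cyclic_prod (fun i => (p ^ lambda i)%N)])|
    = (p ^ \sum_(i < k) minn e (lambda i))%N.
Proof.
move=> p_pr l_gt0; rewrite expn_sum.
have p_gt1 i : 1 < p ^ lambda i by rewrite -(expn0 p) ltn_exp2l ?prime_gt1.
transitivity #|setXn (fun i : 'I_k => 'Ldiv_(p ^ e)([set: 'Z_(p ^ lambda i)]))|.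
  apply: eq_card => x; rewrite !inE /=; apply/eqP/forallP=> [x1 i | x1].
    by rewrite !inE -(morphX (dffun_morphism _ i)) ?inE //= x1 oneg_ffun.
  apply/ffunP=> i; have /[!inE]/eqP xi := x1 i.
  by rewrite -[LHS]/(dffun_morphism _ i _) morphX ?inE //= xi oneg_ffun.
rewrite cardsXn; apply: eq_bigr => i _; apply: card_Ldiv_cyclic => //.
  by apply/cyclicP; exists (@Zp1 (Zp_trunc (p ^ lambda i)).+1); apply: Zp_cycle.
by rewrite cardsT card_ord Zp_cast.
Qed.

Lemma cyclic_prod_abelian (k : nat) (m : 'I_k -> nat) :
  abelian [set: cyclic_prod m].
Proof.
apply/centsP=> x _ y _; apply/ffunP=> i.
by rewrite !mulg_ffun Zp_mulgC.
Qed.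

Lemma sum_ltn_ord k t : t <= k -> (\sum_(i < k) (i < t) = t)%N.
Proof.
move=> le_tk; rewrite -[RHS]card_ord -sum1_card.
rewrite (big_ord_widen k (fun=> 1%N)) // [RHS]big_mkcond.
by apply: eq_bigr => i _; case: (i < t).
Qed.

Local Open Scope ring_scope.

(** * Gaussian binomial coefficients *)

Lemma prod_expB1_neq0 p n :
  (1 < p)%N -> \prod_(1 <= i < n.+1) (p%:R ^+ i - 1) != 0 :> rat.
Proof.
move=> p_gt1; rewrite prodf_seq_neq0; apply/allP=> i.
rewrite mem_index_iota => /andP[i_gt0 _].
by rewrite implyTb subr_eq0 -natrX pnatr_eq1 -(expn0 p) eqn_exp2l // -lt0n.
Qed.

Lemma gauss_binom0 p n : (1 < p)%N -> gauss_binom p n 0 = 1.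
Proof.
by move=> ?; rewrite /gauss_binom subn0 (big_geq (leqnn 1)) mul1r divff ?prod_expB1_neq0.
Qed.

Lemma gauss_binomnn p n : (1 < p)%N -> gauss_binom p n n = 1.
Proof.
by move=> ?; rewrite /gauss_binom subnn (big_geq (leqnn 1)) mulr1 divff ?prod_expB1_neq0.
Qed.

Lemma gauss_binomSS p n m : 
  gauss_binom p n.+1 m.+1 = (p%:R ^+ n.+1 - 1) / (p%:R ^+ m.+1 - 1) * gauss_binom p n m.
Proof.
rewrite /gauss_binom subSS (big_nat_recr n.+1) //= (big_nat_recr m.+1) //=.
rewrite !invfM; set a := _^-1; set b := _^-1; set c := _^-1; ring.
Qed.

(** * Subgroups of an elementary abelian group *)

(** For [b = 0] the subgroup [W] is trivial and this counts all subgroups of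
order [p ^ m]; for [m = d] it counts the complements of [W]. A nontrivial
element of a subgroup [H] that meets [W] trivially lies in [V :\: W], and
modulo such an element [x] the situation is the same with [m] and [d] both
decreased by one, while [W] keeps its order. Counting pairs [(x, H)] gives the
recursion
  [N (m.+1, d.+1) * (p ^ m.+1 - 1) = (p ^ (b + d.+1) - p ^ b) * N (m, d)]. *)
Lemma card_subgroups_trivI m d (gT : finGroupType) (p b : nat) (V W : {group gT}) :
    prime p -> p.-abelem V -> W \subset V ->
    #|V| = (p ^ (b + d))%N -> #|W| = (p ^ b)%N -> (m <= d)%N ->
  (#|[set H : {group gT} | [&& H \subset V, H :&: W == 1%g & #|H| == (p ^ m)%N]]|%:R
    = p%:R ^+ (b * m) * gauss_binom p d m)%R.
Proof.
move=> p_pr; have p_gt1 := prime_gt1 p_pr.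
elim: m d gT V W => [|m IHm] d gT V W abV sWV oV oW le_md.
  rewrite muln0 mul1r gauss_binom0 //.
  rewrite (_ : [set H : {group gT} | _] = [set 1%G]) ?cards1 //.
  apply/setP=> H; rewrite !inE -trivg_card1; apply/and3P/eqP=> [[_ _ /eqP eH]|->].
    exact: val_inj.
  by rewrite sub1G (setIidPl (sub1G W)).
case: d le_md oV => // d le_md oV.
set F := [set H : {group gT} | _].
have cVV : abelian V := abelem_abelian abV.
have FP H : H \in F -> [/\ H \subset V, H :&: W = 1%g & #|H| = (p ^ m.+1)%N].
  by rewrite inE => /and3P[? /eqP ? /eqP ?].
have dcount : (\sum_(H in F) #|H^#| = \sum_(x in V :\: W) #|[set H in F | x \in H]|)%N.
  transitivity (\sum_(H in F) \sum_(x in H^#) 1)%N.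
    by apply: eq_bigr => H _; rewrite sum1_card.
  rewrite (exchange_big_dep (mem (V :\: W))) /=; last first.
    move=> H x /FP[sHV tiHW _] /setD1P[nx1 Hx]; rewrite inE (subsetP sHV) // andbT.
    by apply: contra nx1 => Wx; have: x \in H :&: W; [rewrite inE Hx | rewrite tiHW inE].
  apply: eq_bigr => x /setDP[_ nWx]; rewrite -sum1_card; apply: eq_bigl => H.
  have nx1 : x != 1%g by apply: contraNneq nWx => ->; apply: group1.
  by rewrite [in RHS]in_set in_setD1 nx1.
(* The subgroups through [x] are counted in the quotient by [<[x]>]. *)
have fibre x : x \in V :\: W ->
    #|[set H in F | x \in H]|%:R = p%:R ^+ (b * m) * gauss_binom p d m.
  case/setDP=> Vx nWx; set Q := <[x]>%G.
  have sQV : Q \subset V by rewrite cycle_subG.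
  have nQ (H : {group gT}) : H \subset V -> H \subset 'N(Q).
    by move=> sHV; apply: (subset_trans sHV); apply: sub_abelian_norm.
  have oQ : #|Q| = p.
    by apply: (abelem_order_p abV Vx); apply: contraNneq nWx => ->; apply: group1.
  (* [Q] has prime order and is not contained in [W]. *)
  have tiWQ : W :&: Q = 1%g.
    by rewrite setIC prime_TIg ?oQ // cycle_subG.
  have oH (H : {group gT}) : Q \subset H -> H \subset V -> (#|(H / Q)%g| * p = #|H|)%N.
    by move=> sQH sHV; rewrite card_quotient ?nQ // -oQ mulnC Lagrange.
  rewrite -(IHm d _ (V / Q)%G (W / Q)%G) ?quotient_abelem ?quotientS //.
  - rewrite -(card_subgroups_quotient
        (fun X => (X :&: (W / Q)%g == 1%g) && (#|X| == (p ^ m)%N))); last first.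
      by rewrite /normal sQV nQ.
    congr (_%:R); apply: eq_card => H; rewrite !inE cycle_subG.
    case Hx: (x \in H); rewrite ?andbF ?andbT //=.
    case sHV: (H \subset V) => //=.
    have sQH : Q \subset H by rewrite cycle_subG.
    rewrite -[#|H|]oH // expnSr eqn_pmul2r ?prime_gt0 //; congr (_ && _).
    rewrite -quotientGI //; apply/eqP/eqP=> [->|tiHW]; first exact: quotient1.
    apply/trivgP; rewrite -tiWQ subsetI subsetIr /=.
    rewrite -quotient_sub1 ?tiHW //.
    by apply: nQ; apply: subset_trans sHV; apply: subsetIl.
  - apply/eqP; rewrite -(eqn_pmul2r (prime_gt0 p_pr)) oH // oV.
    by rewrite addnS expnSr.
  - rewrite -oW; apply/esym/card_isog; apply: quotient_isog; first exact: nQ.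
    by rewrite setIC.
have p0 i : (p%:R ^+ i.+1 - 1 : rat) != 0.
  by rewrite subr_eq0 -natrX pnatr_eq1 -(expn0 p) eqn_exp2l.
apply: (mulIf (p0 m)); rewrite gauss_binomSS.
transitivity ((\sum_(H in F) #|H^#|)%:R : rat).
  rewrite mulr_natl -sumr_const raddf_sum /=; apply: eq_bigr => H /FP[_ _ oH].
  have -> : #|H^#| = (p ^ m.+1 - 1)%N by rewrite -oH (cardsD1 1%g H) group1 addKn.
  by rewrite natrB ?natrX // expn_gt0 ltnW.
rewrite dcount natr_sum (eq_bigr _ fibre) sumr_const.
rewrite -[X in X = _]mulr_natl cardsD (setIidPr sWV) oV oW natrB ?leq_exp2l ?leq_addr //.
rewrite !natrX exprD mulnS exprD.
have := p0 m; set y := _ - 1 => y0; set c := gauss_binom _ _ _.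
by field.
Qed.

Lemma sum_subgroups_abelem (gT : finGroupType) (p n : nat) (V : {group gT})
    (g : nat -> rat) :
    prime p -> p.-abelem V -> #|V| = (p ^ n)%N ->
  \sum_(H : {group gT} | H \subset V) g (logn p #|H|)
    = \sum_(0 <= m < n.+1) g m * gauss_binom p n m.
Proof.
move=> p_pr abV oV; have pV := abelem_pgroup abV.
have lg (H : {group gT}) : H \subset V -> (logn p #|H| < n.+1)%N.
  by move=> sHV; rewrite ltnS -(pfactorK n p_pr) -oV dvdn_leq_log ?cardSg ?cardG_gt0.
rewrite (partition_big
  (fun H : {group gT} => inord (logn p #|H|) : 'I_n.+1) xpredT) //=.
rewrite big_mkord; apply: eq_bigr => m _.
have le_mn : (m <= n)%N by rewrite -ltnS.
have := @card_subgroups_trivI m n gT p 0 V 1%G p_pr abV (sub1G V) oV (cards1 _) le_mn.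
rewrite mul0n mul1r => <-.
rewrite mulr_natr -sumr_const; apply: eq_big => [H|H]; last first.
  by case/andP=> sHV /eqP<-; rewrite inordK ?lg.
rewrite inE (setIidPr (sub1G H)) eqxx /=; case sHV: (H \subset V) => //=.
have pH := pgroupS sHV pV; apply/eqP/eqP=> [<-|->]; last first.
  by rewrite pfactorK // inord_val.
by rewrite inordK ?lg // -p_part part_pnat_id.
Qed.

(** * Subgroups with prescribed image and kernel under a morphism *)

(** The quotient map by [S] turns the subgroups [H] with image [K] and kernel
[S] into the complements of ['ker f / S] in [f @*^-1 K / S]: a subgroup between
[S] and [f @*^-1 K] has kernel [S] iff its quotient meets ['ker f / S]
trivially, and then its image is all of [K] iff it has the right order. *)
Lemma card_subgroups_morphim_ker (aT rT : finGroupType) (p r b : nat)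
    (G : {group aT}) (f : {morphism G >-> rT}) (S : {group aT}) (K : {group rT}) :
    prime p -> S \subset 'ker f -> K \subset f @* G -> S <| f @*^-1 K ->
    p.-abelem (f @*^-1 K / S)%g ->
    #|K| = (p ^ r)%N -> #|'ker f| = (p ^ b * #|S|)%N ->
  #|[set H : {group aT} | [&& H \subset G, f @* H == K & 'ker_H f == S]]|
    = (p ^ (r * b))%N.
Proof.
move=> p_pr sSA sKG nSL abL oK oA.
set L := (f @*^-1 K)%G in nSL abL *; set A := 'ker f in sSA oA *.
have sAL : A \subset L by apply: morphpreS; rewrite sub1G.
have oQ (H : {group aT}) :
    S \subset H -> H \subset L -> (#|(H / S)%g| * #|S| = #|H|)%N.
  move=> sSH sHL; rewrite card_quotient ?(subset_trans sHL (normal_norm nSL)) //.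
  by rewrite mulnC Lagrange.
have oH (H : {group aT}) : H \subset G -> (#|f @* H| * #|'ker_H f| = #|H|)%N.
  by move=> sHG; rewrite card_morphim (setIidPr sHG) mulnC LagrangeI.
have oL : #|L| = (#|A| * #|K|)%N by rewrite card_morphpre.
apply/eqP; rewrite -(eqr_nat rat) natrX mulnC.
rewrite -[X in _ == X]mulr1 -[X in _ * X](gauss_binomnn r (prime_gt1 p_pr)).
rewrite -(card_subgroups_trivI (V := (L / S)%G) (W := (A / S)%G)) ?quotientS //; last first.
- apply/eqP; rewrite -(eqn_pmul2r (cardG_gt0 S)) oQ // oA; exact/eqxx.
- apply/eqP; rewrite -(eqn_pmul2r (cardG_gt0 S)) oQ //; last exact: subset_trans sAL.
  by rewrite oL oA oK expnD mulnAC.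
rewrite -(card_subgroups_quotient
   (fun X => (X :&: (A / S)%g == 1%g) && (#|X| == (p ^ r)%N))) //.
rewrite eqr_nat; apply/eqP/eq_card => H; rewrite !inE.
have nSI (X : {group aT}) : S \subset X -> X \subset L -> (X / S == 1)%g -> X \subset S.
  move=> sSX sXL; rewrite -subG1 quotient_sub1 //.
  exact: subset_trans sXL (normal_norm nSL).
apply/and3P/and4P => [[sHG /eqP fH /eqP kH] | [sSH sHL tiHA /eqP oHS]].
  have sSH : S \subset H by rewrite -kH subsetIl.
  have sHL : H \subset L by rewrite -sub_morphim_pre // fH.
  split=> //; first by rewrite -quotientGI //= kH trivg_quotient.
  rewrite -(eqn_pmul2r (cardG_gt0 S)) oQ // -oK -fH.
  by have := oH H sHG; rewrite kH => ->.
have sHG : H \subset G by apply: subset_trans sHL (subsetIl _ _).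
have kH : 'ker_H f = S.
  apply/eqP; rewrite eqEsubset subsetI sSH sSA !andbT.
  apply: (nSI (H :&: A)%G); first by rewrite subsetI sSH.
    exact: subset_trans (subsetIl _ _) sHL.
  by rewrite /= quotientGI.
split=> //; last exact/eqP.
rewrite eqEcard sub_morphim_pre // sHL oK -oHS.
have := oH H sHG; rewrite kH -(leq_pmul2r (cardG_gt0 S)) oQ // => ->.
exact: leqnn.
Qed.

(** * Subgroups of exponent p^2 of an abelian group *)

(** Only the numbers of solutions of [x ^+ p = 1] and [x ^+ (p ^ 2) = 1] matter:
a subgroup of exponent [p ^ 2] lies in the second of these solution sets, whose
isomorphism type is determined by the two numbers. *)
Lemma card_subgroups_exponent_p2 (gT : finGroupType) (p k t : nat) (G : {group gT}) :
    prime p -> abelian G ->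
    #|'Ldiv_p(G)| = (p ^ k)%N -> #|'Ldiv_(p ^ 2)(G)| = (p ^ (k + t))%N ->
  #|subgroups_of_exponent (p ^ 2) G|%:R
    = \sum_(1 <= r < t.+1) \sum_(0 <= s < (k - r).+1)
        p%:R ^+ (r * (k - r - s)) * gauss_binom p (k - r) s * gauss_binom p t r.
Proof.
move=> p_pr cGG; have p_gt1 := prime_gt1 p_pr.
have fM : {in G &, {morph (fun x => x ^+ p)%g : x y / (x * y)%g}}.
  by move=> x y Gx Gy; apply: expgMn; apply: (centsP cGG).
pose f := Morphism fM; pose A := ('ker f)%G; pose B := (f @*^-1 A)%G.
pose M := (f @* B)%G.
have sBG : B \subset G by apply: subsetIl.
have sAG : A \subset G by apply: subsetIl.
have inA x : (x \in A) = (x \in G) && (x ^+ p == 1)%g.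
  by rewrite !inE.
have inB x : (x \in B) = (x \in G) && (x ^+ (p ^ 2) == 1)%g.
  rewrite !inE /= expgnA; case Gx: (x \in G) => //=.
  by rewrite groupX.
have -> : #|'Ldiv_p(G)| = #|A| by apply: eq_card => x; rewrite inA !inE.
have -> : #|'Ldiv_(p ^ 2)(G)| = #|B| by apply: eq_card => x; rewrite inB !inE.
move=> oA oB.
have sAB : A \subset B by apply: ker_sub_pre.
have sMA : M \subset A.
  by rewrite /M /= sub_morphim_pre.
have abA : p.-abelem A.
  rewrite abelemE // (abelianS sAG cGG) /=; apply/exponentP=> x.
  by rewrite inA => /andP[_ /eqP].
have abM : p.-abelem M := abelemS sMA abA.
have oM : #|M| = (p ^ t)%N.
  apply/eqP; rewrite -(eqn_pmul2l (cardG_gt0 A)) [X in _ == (X * _)%N]oA -expnD -oB.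
  rewrite card_morphim (setIidPr sBG) -(LagrangeI B ('ker f)).
  by rewrite (setIidPr sAB).
(* Exponent [p ^ 2] means: [p ^ 2] kills [H], but [p] does not. *)
have in_exp (H : {group gT}) : (H \in subgroups_of_exponent (p ^ 2) G)
    = [&& H \subset G, (f @* H)%G \subset M & (f @* H)%G != 1%G].
  rewrite inE; case sHG: (H \subset G) => //=.
  have -> : (f @* H \subset M) = (exponent H %| p ^ 2)%N.
    rewrite /M /= sub_morphim_pre // morphimGK //.
    apply/subsetP/exponentP => HB x Hx.
      by have /[!inB]/andP[_ /eqP] := HB x Hx.
    by rewrite [_ \in _]inB (subsetP sHG) //; apply/eqP/HB.
  have -> : ((f @* H)%G == 1%G) = (exponent H %| p)%N.
    rewrite -val_eqE /= -subG1 sub_morphim_pre //.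
    apply/subsetP/exponentP => HB x Hx.
      by have := HB x Hx; rewrite inA => /andP[_ /eqP].
    by rewrite [_ \in _]inA (subsetP sHG) //; apply/eqP/HB.
  apply/eqP/andP=> [->|[/(dvdn_pfactor _ _ p_pr)[e le_e2 ->]]].
    by rewrite dvdnn -[X in (_ %| X)%N]expn1 dvdn_Pexp2l.
  by rewrite -[X in (_ %| X)%N]expn1 dvdn_Pexp2l // -ltnNge; case: e le_e2 => [|[|[]]].
have fibre (K S : {group gT}) : K \subset M -> K \subset S -> S \subset A ->
  #|[set H : {group gT} | [&& H \subset G, f @* H == K & 'ker_H f == S]]|
    = (p ^ (logn p #|K| * (k - logn p #|S|)))%N.
  move=> sKM sKS sSA.
  have pA := abelem_pgroup abA; have pS := pgroupS sSA pA.
  have pK := pgroupS sKS pS.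
  have sKG : K \subset f @* G by apply: subset_trans sKM _; apply: morphimS.
  have sLG : f @*^-1 K \subset G := subsetIl _ _.
  have sSL : S \subset f @*^-1 K by apply: subset_trans sSA _; apply: ker_sub_pre.
  apply: card_subgroups_morphim_ker => //.
  - by rewrite -sub_abelian_normal //; apply: abelianS sLG cGG.
  - rewrite abelemE // quotient_abelian ?(abelianS sLG cGG) //=.
    apply/exponentP=> _ /morphimP[y nSy /morphpreP[Gy Ky] ->].
    by rewrite -morphX //= coset_id // (subsetP sKS).
  - exact: card_pgroup.
  rewrite {2}(card_pgroup pS) -expnD subnK //.
  by rewrite -(pfactorK k p_pr) -oA dvdn_leq_log ?cardSg.
(* The contribution of one [K] of order [p ^ r]: the sum over [S] becomes a sum
   over the subgroups [S / K] of [A / K], an elementary abelian group of rank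
   [k - r]. *)
pose g r := \sum_(0 <= s < (k - r).+1)
  (p ^ (r * (k - (r + s))))%:R * gauss_binom p (k - r) s.
have sumS (K : {group gT}) : K \subset M ->
    (\sum_(S : {group gT} | (K \subset S) && (S \subset A))
       p ^ (logn p #|K| * (k - logn p #|S|)))%:R = g (logn p #|K|).
  move=> sKM; have sKA := subset_trans sKM sMA.
  have pK := pgroupS sKA (abelem_pgroup abA).
  have cAA := abelem_abelian abA.
  have nKA : K <| A by rewrite -sub_abelian_normal.
  rewrite /g; have oAK : #|(A / K)%g| = (p ^ (k - logn p #|K|))%N.
    rewrite card_quotient ?normal_norm // -divgS // oA {1}(card_pgroup pK).
    rewrite expnB ?prime_gt0 //.
    by rewrite -(pfactorK k p_pr) -oA dvdn_leq_log ?cardSg.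
  have /= <- := sum_subgroups_abelem (V := (A / K)%G)
    (fun s => (p ^ (logn p #|K| * (k - (logn p #|K| + s))))%:R)
    p_pr (quotient_abelem K abA) oAK.
  rewrite natr_sum.
  have := big_subgroups_quotient +%R predT (fun X =>
    (p ^ (logn p #|K| * (k - (logn p #|K| + logn p #|X|))))%:R : rat) nKA.
  under [in RHS]eq_bigl do rewrite andbT.
  move=> /= <-; apply: eq_big => S; rewrite ?andbT // => /andP[sKS sSA].
  have nKS : S \subset 'N(K) := subset_trans sSA (normal_norm nKA).
  by rewrite -lognM ?cardG_gt0 // card_quotient // Lagrange.
rewrite -sum1_card (partition_big (fun H : {group gT} => (f @* H)%G)
   (fun K : {group gT} => (K \subset M) && (K != 1%G))) /=; last first.
  by move=> H; rewrite in_exp => /and3P[_ -> ->].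
rewrite natr_sum.
(* [K = 1] would give the subgroups of exponent dividing [p]: it is kept as an
   index with weight [0], so that [K] runs over all subgroups of [M]. *)
transitivity (\sum_(K : {group gT} | K \subset M)
   (if logn p #|K| is 0 then 0 else g (logn p #|K|))).
  rewrite [RHS](bigID (fun K : {group gT} => K == 1%G)) /= [X in _ = X + _]big1 ?add0r; last first.
    by move=> K /andP[_ /eqP ->]; rewrite cards1 logn1.
  apply: eq_bigr => K /andP[sKM ntK].
  rewrite -sumS //.
  case Er: (logn p #|K|) => [|r].
    have pK := pgroupS (subset_trans sKM sMA) (abelem_pgroup abA).
    by case/eqP: ntK; apply: val_inj; apply: card1_trivg; rewrite (card_pgroup pK) Er.
  rewrite -Er; congr _%:R.
  rewrite (partition_big (fun H : {group gT} => ('ker_H f)%G)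
    (fun S : {group gT} => (K \subset S) && (S \subset A))) /=; last first.
    move=> H; rewrite in_exp => /andP[/and3P[sHG sfM _] /eqP <-].
    rewrite subsetIr subsetI (subset_trans sfM sMA) !andbT.
    (* [f H] consists of powers of elements of [H]. *)
    by apply/subsetP=> _ /morphimP[x Gx Hx ->] /=; apply: groupX.
  apply: eq_bigr => S /andP[sKS sSA]; rewrite -fibre // -sum1_card.
  have groupE (X Y : {group gT}) : (X == Y) = (X == Y :> {set gT}) by [].
  apply: eq_bigl => H; rewrite inE in_exp !groupE /=.
  rewrite groupE in ntK.
  case: (f @* H =P K) => [fH|]; last by rewrite !andbF.
  by rewrite fH sKM ntK !andbT.
rewrite (sum_subgroups_abelem (fun r => if r is 0 then 0 else g r) p_pr abM oM).
rewrite [LHS]big_ltn //= mul0r add0r; apply: eq_big_nat => -[|r] // _.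
rewrite mulr_suml; apply: eq_bigr => s _.
by rewrite natrX subnDA.
Qed.

Theorem proposition2p4 (p k t : nat) (lambda : 'I_k -> nat)
    (p_prime : prime p) (k_ge1 : (1 <= k)%N) (t_le_k : (t <= k)%N)
    (lambda_noninc : forall i j : 'I_k, (i <= j)%N -> (lambda j <= lambda i)%N)
    (lambda_gt1 : forall i : 'I_k, (i < t)%N -> (1 < lambda i)%N)
    (lambda_eq1 : forall i : 'I_k, (t <= i)%N -> lambda i = 1%N) :
  let E := subgroups_of_exponent (p ^ 2)%N
             [set: cyclic_prod (fun i : 'I_k => (p ^ lambda i)%N)]%G in
  #|E|%:R =
    \sum_(1 <= r < t.+1) \sum_(0 <= s < (k - r).+1)
      p%:R ^+ (r * (k - r - s))%N * gauss_binom p (k - r)%N s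
        * gauss_binom p t r
  /\ (t = 0%N -> #|E| = 0%N).
Proof.
have l_gt0 i : (0 < lambda i)%N.
  by case: (ltnP i t) => [/lambda_gt1/ltnW | /lambda_eq1->].
move=> E; set rhs := \sum_(1 <= r < _) _.
have cardE : #|E|%:R = rhs.
  apply: card_subgroups_exponent_p2 => //; first exact: cyclic_prod_abelian.
    rewrite -[X in 'Ldiv_X()]expn1 card_Ldiv_cyclic_prod //; congr (p ^ _)%N.
    rewrite (eq_bigr (fun=> 1%N)) => [|i _]; last exact/minn_idPl.
    by rewrite sum1_card card_ord.
  rewrite card_Ldiv_cyclic_prod //; congr (p ^ _)%N.
  rewrite (eq_bigr (fun i : 'I_k => 1 + (i < t))%N) => [|i _].
    by rewrite big_split /= sum1_card card_ord sum_ltn_ord.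
  case: (ltnP i t) => [/lambda_gt1/minn_idPl-> | /lambda_eq1->] //.
split=> // t0; apply/eqP; rewrite -(pnatr_eq0 rat) cardE /rhs t0.
by rewrite big_geq.
Qed.
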